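(* Let $0<a<1$ and let $g\in H^2(\mathbb{D})$ be such that $\lim_{z\to 1,\ z\in\mathbb{D}} g(z)=L$ exists with $L\in\mathbb{C}$, $L\neq 0$. Then $K_g$ contains the constant functions. In particular, if $K_g$ is a minimal invariant subspace of $C_{\phi_a}$, then $g\equiv L$ and $\dim K_g=1$.
   Context: $H^2=H^2(\mathbb{D})$ is the Hardy-Hilbert space of holomorphic functions on the open unit disk $\mathbb{D}$. For $a\in(0,1)$, $\phi_a(z)=az+1-a$, a holomorphic self-map of $\mathbb{D}$, and $C_{\phi_a}f=f\circ\phi_a$ is the (bounded) composition operator on $H^2$. For $f\in H^2$, $K_f:=\overline{\mathrm{span}\{f,C_{\phi_a}f,C_{\phi_a}^2f,\ldots\}}$ (closure in $H^2$). A minimal invariant subspace of $C_{\phi_a}$ is a nonzero closed invariant subspace whose only closed $C_{\phi_a}$-invariant subspaces are $\{0\}$ and itself. *)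

(* Defs.v *)
From HB Require Import structures.
From mathcomp Require Import all_boot all_order all_algebra.
From mathcomp Require Import complex.
From mathcomp Require Import all_classical all_reals all_analysis.

Set Implicit Arguments.
Unset Strict Implicit.
Unset Printing Implicit Defensive.

Import Order.TTheory GRing.Theory Num.Theory.
Import numFieldNormedType.Exports.

Local Open Scope classical_set_scope.
Local Open Scope ring_scope.

(* Packing R[i] as a numFieldType (instead of using the bare type R[i]) is what
   makes the library's norm topology of an abstract numFieldType apply to it. *)
Definition Cplx (R : realType) : numFieldType := R[i]%C.

Definition toC (R : realType) (x : R) : Cplx R := x%:C%C.

Definition cabs (R : realType) (z : Cplx R) : R := ComplexField.Normc.normc z.

Section DiskSection.
Variable R : realType.
Local Notation C := (Cplx R).

Definition disk : Type := {z : C | `|z| < 1}.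

(* The filter "z -> 1, z in the disk": traces on the disk of the neighbourhoods
   of 1 in the plane. *)
Definition disk_to_1 : set_system disk :=
  [set U | \forall z \near (1 : C), forall w : disk, val w = z -> U w].

Definition phi (a : R) (z : C) : C := toC a * z + 1 - toC a.

Lemma phi_disk (a : R) (ha : 0 < a < 1) (z : disk) : `|phi a (val z)| < 1.
Proof.
have /andP[a0 a1] := ha.
have a0' : (0 : C) < toC a by rewrite /toC -[0]/((0 : R)%:C%C) ltcR.
have a1' : toC a < (1 : C) by rewrite /toC -[1]/((1 : R)%:C%C) ltcR.
rewrite /phi -addrA; apply: (le_lt_trans (ler_normD _ _)).
rewrite normrM (gtr0_norm a0') (@gtr0_norm _ (1 - toC a)) ?subr_gt0//.
by rewrite addrCA -[ltRHS]addr0 ltrD2l subr_lt0 gtr_pMr// (valP z).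
Qed.

Definition phiD (a : R) (ha : 0 < a < 1) (z : disk) : disk :=
  exist _ (phi a (val z)) (phi_disk ha z).

Definition comp_op (a : R) (ha : 0 < a < 1) (f : disk -> C) : disk -> C :=
  f \o phiD ha.

Definition power_series_of (f : disk -> C) (u : nat -> C) : Prop :=
  forall z : disk, series (fun n => u n * val z ^+ n) @ \oo --> f z.

(* Holomorphic functions on the disk with square-summable Taylor coefficients
   at 0. *)
Definition H2 : set (disk -> C) :=
  [set f | exists u : nat -> C,
     power_series_of f u /\ cvgn (series (fun n => cabs (u n) ^+ 2))].

(* Meaningful for f with a power series on the disk, whose coefficients are
   then unique. *)
Definition taylor (f : disk -> C) : nat -> C :=
  xget (fun=> 0) [set u | power_series_of f u].

(* Meaningful for f in H2. *)
Definition H2norm (f : disk -> C) : R :=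
  Num.sqrt (limn (series (fun n => cabs (taylor f n) ^+ 2))).

(* Closure in the normed space H2 of the part of S lying in H2; all the sets S
   considered are included in H2. *)
Definition H2closure (S : set (disk -> C)) : set (disk -> C) :=
  [set f | H2 f /\
     forall e : R, 0 < e -> exists2 p, (S `&` H2) p & H2norm (f - p) < e].

Definition lin_span (S : set (disk -> C)) : set (disk -> C) :=
  [set p | exists n (c : 'I_n -> C) (f : 'I_n -> disk -> C),
     (forall i, S (f i)) /\ p = \sum_(i < n) c i *: f i].

Definition has_dim (n : nat) (M : set (disk -> C)) : Prop :=
  exists e : 'I_n -> disk -> C,
    (forall c : 'I_n -> C, \sum_(i < n) c i *: e i = 0 -> forall i, c i = 0) /\
    M = lin_span (range e).

Definition closed_subspace (M : set (disk -> C)) : Prop :=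
  [/\ M `<=` H2, M 0,
      forall (c : C) u v, M u -> M v -> M (c *: u + v) &
      H2closure M `<=` M].

Definition closed_invariant (a : R) (ha : 0 < a < 1) (M : set (disk -> C)) :
  Prop :=
  closed_subspace M /\ forall f, M f -> M (comp_op ha f).

Definition minimal_invariant (a : R) (ha : 0 < a < 1) (M : set (disk -> C)) :
  Prop :=
  [/\ closed_invariant ha M, M <> [set 0] &
      forall N, closed_invariant ha N -> N `<=` M -> N = [set 0] \/ N = M].

Definition K (a : R) (ha : 0 < a < 1) (f : disk -> C) : set (disk -> C) :=
  H2closure (lin_span (range (fun n => iter n (comp_op ha) f))).

End DiskSection.

(* Main.v *)
Require Import Defs.
From mathcomp Require Import all_boot all_order all_algebra.
From mathcomp Require Import complex.
From mathcomp Require Import all_classical all_reals all_analysis.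
From mathcomp Require Import ring lra.
Import Order.TTheory GRing.Theory Num.Theory.
Import numFieldNormedType.Exports.
Local Open Scope classical_set_scope.
Local Open Scope ring_scope.

Set Implicit Arguments.
Unset Strict Implicit.
Unset Printing Implicit Defensive.

(** Iterating the affine map sends the disk into smaller and smaller
    neighbourhoods of its fixed point 1, since [1 - phi z = a (1 - z)]. As [g]
    tends to [L] at 1, the iterates [C^n g] tend to [L] uniformly on the disk
    (lemma [orbit_cvg_uniform]). The H2 norm is dominated by the supremum norm
    ([bounded_H2]), so the convergence also holds in H2 and [K_g] contains the
    constant [L], hence all constants as [L] is not zero ([constants_in_K]).

    The constants form a nonzero closed invariant subspace. The only delicate
    point is closedness, where an H2 limit of constants has coefficients of
    positive index arbitrarily small ([constants_closed]). If [K_g] is minimal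
    it is therefore the line of constants, and [g], which belongs to [K_g], is
    a constant, necessarily equal to its limit [L].

    Two facts of function theory support this. The inequality between the
    norms is that a power series bounded by [e] on the disk satisfies
    [\sum_n |u n|^2 <= e^2] ([coef_sum_le]): Parseval's identity on a circle,
    obtained here by iterating the parallelogram law on polynomials whose
    number of coefficients is a power of 2 ([dyadic_coef_bound]). With [e = 0]
    it also yields the uniqueness of the coefficients ([power_series_unique]).
    The other fact is that [f \o phi] is again the sum of a power series
    centred at 0, by an absolutely convergent rearrangement
    ([comp_power_series]). An iterate uniformly close to [L] is then a bounded
    power series, so it belongs to H2 by [bounded_H2]. *)

(** * The modulus as a real number *)

Section Modulus.
Variable R : realType.
Local Notation C := (Cplx R).
Implicit Types x y z : C.

Lemma normr_toC z : `|z| = toC (cabs z).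
Proof. by case: z. Qed.

Lemma ltr_toC (x y : R) : (toC x < toC y) = (x < y).
Proof. exact: ltcR. Qed.

Lemma toCB (x y : R) : toC (x - y) = toC x - toC y :> C.
Proof. exact: raddfB. Qed.

Lemma toCM (x y : R) : toC (x * y) = toC x * toC y :> C.
Proof. exact: rmorphM. Qed.

Lemma toCX (x : R) n : toC (x ^+ n) = toC x ^+ n :> C.
Proof. exact: rmorphXn. Qed.

Lemma toC_nat n : toC (n%:R) = n%:R :> C.
Proof. exact: rmorph_nat. Qed.

Lemma cabs_ge0 z : 0 <= cabs z.
Proof. by case: z => x y; rewrite sqrtr_ge0. Qed.

Lemma cabs0 : cabs (0 : C) = 0.
Proof. exact: ComplexField.Normc.normc0. Qed.

Lemma cabs1 : cabs (1 : C) = 1.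
Proof. exact: ComplexField.Normc.normc1. Qed.

Lemma cabs_eq0 z : cabs z = 0 -> z = 0.
Proof. exact: ComplexField.Normc.eq0_normc. Qed.

Lemma cabsM x y : cabs (x * y) = cabs x * cabs y.
Proof. exact: ComplexField.Normc.normcM. Qed.

Lemma cabsX z n : cabs (z ^+ n) = cabs z ^+ n.
Proof. by elim: n => [|n IH]; rewrite ?expr0 ?cabs1// !exprS cabsM IH. Qed.

Lemma cabsD x y : cabs (x + y) <= cabs x + cabs y.
Proof. exact: le_normcD. Qed.

Lemma cabsN z : cabs (- z) = cabs z.
Proof. exact: normcN. Qed.

Lemma cabs_toC (x : R) : cabs (toC x) = `|x|.
Proof. by rewrite /cabs/= expr0n/= addr0 sqrtr_sqr. Qed.

Lemma cabs_sum (I : Type) (r : seq I) (F : I -> C) :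
  cabs (\sum_(i <- r) F i) <= \sum_(i <- r) cabs (F i).
Proof.
elim/big_ind2: _ => [|x1 x2 y1 y2 h1 h2|//]; first by rewrite cabs0.
by apply: (le_trans (cabsD _ _)); exact: lerD.
Qed.

Lemma cabs_sqrE z : cabs z ^+ 2 = complex.Re z ^+ 2 + complex.Im z ^+ 2.
Proof. by case: z => x y; rewrite sqr_sqrtr// addr_ge0// sqr_ge0. Qed.

Lemma cabs_parallelogram x y :
  cabs (x + y) ^+ 2 + cabs (x - y) ^+ 2 = 2 * (cabs x ^+ 2 + cabs y ^+ 2).
Proof. by rewrite !cabs_sqrE; case: x y => [a b] [c d] /=; ring. Qed.

Lemma cabs_Re_le z : `|complex.Re z| <= cabs z.
Proof.
rewrite -(ler_pXn2r (n := 2)) ?nnegrE ?cabs_ge0// cabs_sqrE.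
by rewrite real_normK ?num_real// lerDl sqr_ge0.
Qed.

Lemma cabs_Im_le z : `|complex.Im z| <= cabs z.
Proof.
rewrite -(ler_pXn2r (n := 2)) ?nnegrE ?cabs_ge0// cabs_sqrE.
by rewrite real_normK ?num_real// lerDr sqr_ge0.
Qed.

Lemma cabs_le_ReIm z : cabs z <= `|complex.Re z| + `|complex.Im z|.
Proof.
rewrite -(ler_pXn2r (n := 2)) ?nnegrE ?cabs_ge0 ?addr_ge0// cabs_sqrE sqrrD.
by rewrite !real_normK ?num_real// lerD2r lerDl mulrn_wge0// mulr_ge0.
Qed.

Lemma diskP z : reflect (cabs z < 1) (`|z| < 1).
Proof. by rewrite normr_toC -ltr_toC; exact: idP. Qed.

Lemma disk_cabs (w : disk R) : cabs (val w) < 1.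
Proof. exact/diskP/(valP w). Qed.

(** Convergence in the plane tested with real radii, since the library's
    neighbourhoods of [Cplx R] are balls whose radius is itself complex. *)
Lemma cvgCP (T : Type) (F : set_system T) (FF : Filter F) (f : T -> C) (l : C) :
  f x @[x --> F] --> l <->
  forall e : R, 0 < e -> \forall x \near F, cabs (l - f x) < e.
Proof.
rewrite cvgrPdist_lt; split => [h e e0|h e e0].
  have : 0 < toC e by rewrite -[0]/(toC 0) ltr_toC.
  move=> /h; apply: filterS => x; by rewrite normr_toC ltr_toC.
(* a positive complex number is real *)
have eE : e = toC (complex.Re e).
  by move: e e0 {h} => [e1 e2]; rewrite ltcE /= => /andP[/eqP-> _].
have : 0 < complex.Re e by rewrite -ltr_toC -eE.
by move=> /h; apply: filterS => x; rewrite eE normr_toC ltr_toC.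
Qed.

End Modulus.

(** * Absolutely convergent complex series and power series *)

Section Series.
Variable R : realType.
Local Notation C := (Cplx R).

Lemma seriesE (V : zmodType) (u : nat -> V) n : series u n = \sum_(i < n) u i.
Proof. by rewrite /series/= big_mkord. Qed.

Lemma Re_series (u : nat -> C) n :
  complex.Re (series u n) = series (fun k => complex.Re (u k)) n.
Proof.
by rewrite !seriesE; apply: (big_morph _ (@raddfD _ _ _) (raddf0 _)). Qed.

Lemma Im_series (u : nat -> C) n :
  complex.Im (series u n) = series (fun k => complex.Im (u k)) n.
Proof.
by rewrite !seriesE; apply: (big_morph _ (@raddfD _ _ _) (raddf0 _)). Qed.

Lemma dominated_cvgn (x y : nat -> R) : (forall n, `|x n| <= y n) ->
  cvgn (series y) -> cvgn (series x).
Proof.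
move=> xy cy; apply: (@normed_cvg R R^o).
apply: series_le_cvg cy => n /=; [exact: normr_ge0| |exact: xy].
exact: le_trans (normr_ge0 _) (xy n).
Qed.

(** The plane inherits from the line the convergence of absolutely convergent
    series: the real and imaginary parts are dominated as well. *)
Lemma dominated_cvgC (u : nat -> C) (y : nat -> R) :
  (forall n, cabs (u n) <= y n) -> cvgn (series y) ->
  exists l : C, series u @ \oo --> l.
Proof.
move=> uy cy.
have cR : cvgn (series (fun n => complex.Re (u n))).
  by apply: dominated_cvgn cy => n; exact: le_trans (cabs_Re_le _) (uy n).
have cI : cvgn (series (fun n => complex.Im (u n))).
  by apply: dominated_cvgn cy => n; exact: le_trans (cabs_Im_le _) (uy n).
set A := limn _ in cR; set B := limn _ in cI.
exists (Complex A B); apply/cvgCP => e e0.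
have e20 : 0 < e / 2 by rewrite divr_gt0.
move/cvgrPdist_lt/(_ _ e20): cR => cR.
move/cvgrPdist_lt/(_ _ e20): cI => cI.
near=> n; apply: (le_lt_trans (cabs_le_ReIm _)); rewrite (splitr e).
rewrite !raddfB/= Re_series Im_series.
by apply: ltrD; near: n.
Unshelve. all: by end_near. Qed.

(** Let [n] go to infinity in the triangle inequality between partial sums
    [m] and [n]. Both the uniformity of power series on smaller disks and the
    rearrangement of a double series below come from this estimate. *)
Lemma series_tail (u : nat -> C) (y : nat -> R) (l : C) (T : R) m :
  (forall n, cabs (u n) <= y n) -> series u @ \oo --> l ->
  series y @ \oo --> T -> cabs (l - series u m) <= T - series y m.
Proof.
move=> uy /cvgCP ul /cvgrPdist_lt yT; apply/ler_addgt0Pr => e e0.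
have e20 : 0 < e / 2 by rewrite divr_gt0.
near \oo => n.
have mn : (m <= n)%N by near: n; exact: nbhs_infty_ge.
have h1 : cabs (l - series u n) < e / 2 by near: n; exact: ul.
have h2 : `|T - series y n| < e / 2 by near: n; exact: yT.
have h3 : cabs (series u n - series u m) <= series y n - series y m.
  rewrite !sub_series_geq//; apply: (le_trans (cabs_sum _ _)).
  exact: ler_sum.
have -> : l - series u m = (l - series u n) + (series u n - series u m).
  by rewrite addrA subrK.
have := cabsD (l - series u n) (series u n - series u m).
move: h2; rewrite ltr_norml => /andP[h2 _]; lra.
Unshelve. all: by end_near. Qed.

Lemma disk_toC (r : R) : `|r| < 1 -> `|toC r : C| < 1.
Proof. by move=> r1; apply/diskP; rewrite cabs_toC. Qed.

Definition disk_real (r : R) (hr : `|r| < 1) : disk R :=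
  exist (fun z : C => `|z| < 1) (toC r) (disk_toC hr).

Definition disk0 : disk R :=
  disk_real (eq_ind_r (fun x => x < 1) ltr01 (normr0 R)).

(** The terms are bounded at a point [s] with [r < s < 1], hence dominated at
    radius [r] by a geometric series of ratio [r / s]. *)
Lemma power_series_abs (f : disk R -> C) (u : nat -> C) (r : R) :
  power_series_of f u -> 0 <= r < 1 ->
  cvgn (series (fun n => cabs (u n) * r ^+ n)).
Proof.
move=> fu /andP[r0 r1].
(* any point strictly between r and 1 would do *)
pose s := (r + 1) / 2.
have s0 : 0 < s by rewrite /s; lra.
have s1 : `|s| < 1 by rewrite gtr0_norm// /s; lra.
have rs : r < s by rewrite /s; lra.
have ufs := fu (disk_real s1); rewrite /= in ufs.
have [M M0 hM] : exists2 M, 0 < M & forall n, cabs (u n) * s ^+ n <= M.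
  have := @cvg_series_cvg_0 C C^o _ (@cvgP C _ _ ufs).
  move=> /cvgCP /(_ 1 ltr01)[N _ hN].
  exists (1 + \sum_(n < N) cabs (u n) * s ^+ n).
    rewrite ltr_wpDr// sumr_ge0// => i _.
    by rewrite mulr_ge0 ?cabs_ge0// exprn_ge0// ltW.
  move=> n; have [nN|nN] := ltnP n N.
    rewrite (bigD1 (Ordinal nN))//= addrCA lerDl addr_ge0// sumr_ge0// => i _.
    by rewrite mulr_ge0 ?cabs_ge0// exprn_ge0// ltW.
  have := hN n nN; rewrite /= sub0r cabsN cabsM cabsX cabs_toC gtr0_norm//.
  move=> /ltW h; apply: (le_trans h); rewrite lerDl sumr_ge0// => i _.
  by rewrite mulr_ge0 ?cabs_ge0// exprn_ge0// ltW.
have q1 : `|r / s| < 1.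
  by rewrite ger0_norm ?ltr_pdivrMr ?mul1r// divr_ge0// ltW.
have := @is_cvg_geometric_series _ M (r / s) q1.
apply: dominated_cvgn => n; rewrite /geometric/=.
rewrite ger0_norm ?mulr_ge0 ?cabs_ge0 ?exprn_ge0// expr_div_n mulrA.
rewrite ler_pdivlMr ?exprn_gt0// mulrAC ler_wpM2r ?exprn_ge0//.
Qed.

Lemma power_series_unif (f : disk R -> C) (u : nat -> C) (r : R) :
  power_series_of f u -> 0 <= r < 1 ->
  forall e : R, 0 < e -> \forall m \near \oo, forall z : disk R,
    cabs (val z) <= r ->
    cabs (f z - series (fun n => u n * val z ^+ n) m) < e.
Proof.
move=> fu r01 e e0; have cy := power_series_abs fu r01.
near=> m => z zr.
pose y n := cabs (u n) * r ^+ n.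
apply: (le_lt_trans (@series_tail _ y _ _ m _ (fu z) cy)).
  move=> n; rewrite cabsM cabsX ler_wpM2l ?cabs_ge0//.
  rewrite lerXn2r ?nnegrE ?cabs_ge0//.
  by case/andP: r01.
apply: (le_lt_trans (ler_norm _)); near: m.
by move/cvgrPdist_lt: cy; exact.
Unshelve. all: by end_near. Qed.

End Series.

(** * The supremum on the disk bounds the coefficients *)

Section SupBoundsCoefficients.
Variable R : realType.
Local Notation C := (Cplx R).

Lemma sum_even_odd (V : nmodType) (F : nat -> V) n :
  \sum_(j < n.*2) F j = \sum_(j < n) F j.*2 + \sum_(j < n) F j.*2.+1.
Proof.
elim: n => [|n IH]; first by rewrite !big_ord0 addr0.
by rewrite doubleS !big_ord_recr/= IH -!addrA; congr (_ + _); rewrite addrCA.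
Qed.

(** Parseval's inequality on the unit circle, from the parallelogram law. Split
    a polynomial of degree less than [2 ^ k.+1] as
    [P z = E (z ^ 2) + z * O (z ^ 2)]. If [z] has modulus 1, the law at [z] and
    [- z] gives [|P z|^2 + |P (- z)|^2 = 2 (|E w|^2 + |O w|^2)] with
    [w = z ^ 2], and every [w] of modulus 1 has a square root. Each splitting
    replaces a polynomial by two, so the induction runs over finite families of
    polynomials. *)
Lemma dyadic_coef_bound k (s : seq (nat -> C)) (e : R) :
  (forall z : C, cabs z = 1 ->
     \sum_(v <- s) cabs (\sum_(j < 2 ^ k) v j * z ^+ j) ^+ 2 <= e) ->
  \sum_(v <- s) \sum_(j < 2 ^ k) cabs (v j) ^+ 2 <= e.
Proof.
elim: k s => [|k IH] s hs.
  apply: le_trans (hs 1 (cabs1 _)); apply: ler_sum => v _.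
  by rewrite !big_ord1 expr0 mulr1.
pose ev (v : nat -> C) j := v j.*2; pose od (v : nat -> C) j := v j.*2.+1.
have := IH (map ev s ++ map od s).
rewrite expnS mul2n in hs *.
under [X in _ -> X <= _]eq_bigr do
  rewrite (sum_even_odd (fun j => cabs (_ j) ^+ 2)).
rewrite big_cat/= !big_map -big_split/=; apply=> w w1.
rewrite big_cat/= !big_map -big_split/=.
pose z : C := sqrtc (w : R[i]).
have zw : z ^+ 2 = w by exact: sqr_sqrtc.
have z1 : cabs z = 1.
  by apply/eqP; rewrite -(@eqrXn2 _ 2) ?cabs_ge0// -cabsX zw w1 expr1n.
have split_at (v : nat -> C) (y : C) : y ^+ 2 = w ->
    \sum_(j < (2 ^ k).*2) v j * y ^+ j
    = \sum_(j < 2 ^ k) ev v j * w ^+ j + y * \sum_(j < 2 ^ k) od v j * w ^+ j.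
  move=> yw; rewrite (sum_even_odd (fun j => v j * y ^+ j)) mulr_sumr.
  congr (_ + _); apply: eq_bigr => j _; rewrite -yw -exprM mul2n//.
  by rewrite exprS mulrCA.
have Nz1 : cabs (- z) = 1 by rewrite cabsN.
have := lerD (hs _ z1) (hs _ Nz1); rewrite -big_split/=.
under eq_bigr => v _.
  rewrite (split_at _ _ zw) (split_at _ (- z)) ?sqrrN// mulNr.
  rewrite cabs_parallelogram cabsM z1 mul1r; over.
by rewrite -mulr_sumr -mulr2n -[e *+ 2]mulr_natl ler_pM2l.
Qed.

(** On the circle of radius [r] the partial sums are uniformly close to [f],
    hence bounded by [e + d] for large dyadic lengths. *)
Lemma coef_sum_le_on_circle (f : disk R -> C) (u : nat -> C) (e r : R) N :
  power_series_of f u -> (forall z, cabs (f z) <= e) -> 0 <= r < 1 ->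
  \sum_(j < N) cabs (u j) ^+ 2 * (r ^+ 2) ^+ j <= e ^+ 2.
Proof.
move=> fu fe r01; have /andP[r0 r1] := r01.
have S0 M : 0 <= \sum_(j < M) cabs (u j) ^+ 2 * (r ^+ 2) ^+ j.
  apply: sumr_ge0 => j _.
  by rewrite mulr_ge0// exprn_ge0// ?cabs_ge0// exprn_ge0.
have e0 : 0 <= e := le_trans (cabs_ge0 _) (fe (disk0 R)).
rewrite -[leLHS]sqr_sqrtr// ler_pXn2r ?nnegrE ?sqrtr_ge0//.
apply/ler_addgt0Pr => d d0.
have ed0 : 0 <= e + d by rewrite addr_ge0// ltW.
rewrite -[leRHS]ger0_norm// -sqrtr_sqr ler_wsqrtr//.
have [M _ hM] := power_series_unif fu r01 d0.
pose k := maxn M N.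
have k2 : (k <= 2 ^ k)%N by rewrite ltnW// ltn_expl.
apply: (@le_trans _ _ (\sum_(j < 2 ^ k) cabs (u j) ^+ 2 * (r ^+ 2) ^+ j)).
  have Nk : (N <= 2 ^ k)%N by apply: leq_trans k2; rewrite leq_maxr.
  rewrite -!(big_mkord xpredT (fun j => cabs (u j) ^+ 2 * (r ^+ 2) ^+ j)).
  rewrite (big_cat_nat _ Nk)//= lerDl sumr_ge0// => j _.
  by rewrite mulr_ge0// exprn_ge0// ?cabs_ge0// exprn_ge0.
have := @dyadic_coef_bound k [:: fun j => u j * toC r ^+ j] ((e + d) ^+ 2).
rewrite big_seq1 => H; apply: le_trans (H _).
  apply: ler_sum => j _.
  by rewrite cabsM cabsX cabs_toC ger0_norm// [leRHS]exprMn -!exprM mulnC.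
move=> z z1; rewrite big_seq1 ler_pXn2r ?nnegrE ?cabs_ge0//.
have rz : cabs (toC r * z) = r by rewrite cabsM z1 mulr1 cabs_toC ger0_norm.
have rzD : `|toC r * z| < 1 by apply/diskP; rewrite rz.
pose w : disk R := exist (fun z : C => `|z| < 1) _ rzD.
have := hM (2 ^ k)%N (leq_trans (leq_maxl _ _) k2) w.
rewrite /= rz lexx => /(_ isT) /ltW h.
under eq_bigr do rewrite -mulrA -exprMn.
rewrite -(seriesE (fun j => u j * (toC r * z) ^+ j)).
set S := series _ _ in h *.
have -> : S = f w - (f w - S) by rewrite opprB addrCA subrr addr0.
apply: (le_trans (cabsD _ _)); rewrite cabsN.
exact: lerD.
Qed.

(** Let [r] tend to 1 in the bound on circles: a finite sum is a polynomial in
    [r], so continuity suffices. *)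
Lemma coef_sum_le (f : disk R -> C) (u : nat -> C) (e : R) N :
  power_series_of f u -> (forall z, cabs (f z) <= e) ->
  \sum_(j < N) cabs (u j) ^+ 2 <= e ^+ 2.
Proof.
move=> fu fe.
pose p : {poly R} := \sum_(j < N) (cabs (u j) ^+ 2)%:P * ('X ^+ 2) ^+ j.
have pE x : p.[x] = \sum_(j < N) cabs (u j) ^+ 2 * (x ^+ 2) ^+ j.
  by rewrite /p horner_sum; apply: eq_bigr => j _; rewrite !hornerE.
have -> : \sum_(j < N) cabs (u j) ^+ 2 = p.[1].
  by rewrite pE; apply: eq_bigr => j _; rewrite !expr1n mulr1.
rewrite leNgt; apply/negP => lt1.
have := @cvg_at_left_filter _ _ _ _ _ (@continuous_horner _ p 1).
move=> /cvgr_gt /(_ _ lt1) h.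
near (1 : R)^'- => r.
have : e ^+ 2 < p.[r] by near: r.
rewrite ltNge => /negP; apply; rewrite pE.
apply: (coef_sum_le_on_circle _ fu fe); apply/andP; split => //.
near: r; exact: nbhs_left_ge.
Unshelve. all: by end_near. Qed.

End SupBoundsCoefficients.

(** * Composition with the affine map preserves power series *)

Section Composition.
Variable R : realType.
Local Notation C := (Cplx R).

Lemma sum_ord_zero_tail (V : nmodType) (F : nat -> V) n K : (n <= K)%N ->
  (forall k, (n <= k)%N -> F k = 0) -> \sum_(k < K) F k = \sum_(k < n) F k.
Proof.
move=> nK F0; rewrite -!(big_mkord xpredT F) (big_cat_nat _ nK)//=.
rewrite [X in _ + X]big1_seq ?addr0// => k /andP[_].
by rewrite mem_index_iota => /andP[nk _]; exact: F0.
Qed.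

(** The binomial formula in powers of [x], with a number [K] of terms that
    need not depend on [n]: the binomial coefficients beyond [n] vanish. *)
Lemma affine_expansion (A : comNzRingType) (a x : A) n K : (n < K)%N ->
  (a * x + 1 - a) ^+ n =
  \sum_(k < K) 'C(n, k)%:R * a ^+ k * (1 - a) ^+ (n - k) * x ^+ k.
Proof.
move=> nK; have -> : a * x + 1 - a = (1 - a) + a * x by ring.
rewrite exprDn (sum_ord_zero_tail
  (F := fun k => 'C(n, k)%:R * a ^+ k * (1 - a) ^+ (n - k) * x ^+ k) nK).
- by apply: eq_bigr => k _; rewrite -mulr_natl exprMn; ring.
- by move=> k nk; rewrite bin_small// !mul0r.
Qed.

Lemma affine_expansion_le (a x : R) n K : 0 < a < 1 -> 0 <= x ->
  \sum_(k < K) 'C(n, k)%:R * a ^+ k * (1 - a) ^+ (n - k) * x ^+ k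
  <= (a * x + 1 - a) ^+ n.
Proof.
move=> /andP[a0 a1] x0.
pose F k := 'C(n, k)%:R * a ^+ k * (1 - a) ^+ (n - k) * x ^+ k.
have nK : (n < (n + K).+1)%N by rewrite ltnS leq_addr.
rewrite (affine_expansion a x nK) -!(big_mkord xpredT F).
have Kn : (K <= (n + K).+1)%N by rewrite ltnW// ltnS leq_addl.
rewrite [leRHS](big_cat_nat _ Kn)//= lerDl sumr_ge0// => k _.
by rewrite !mulr_ge0// exprn_ge0// ?subr_ge0// ltW.
Qed.

(** Rearrangement of [\sum_n u n * (a * z + 1 - a) ^+ n] in powers of [z]. With
    [x = |z|], the terms of index [n] of the resulting double series have
    moduli of sum at most [|u n| * (a * x + 1 - a) ^+ n], which is summable as
    [a * x + 1 - a < 1]; the partial sums by rows and by columns then differ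
    by at most the tail of this series. *)
Lemma comp_power_series (a : R) (ha : 0 < a < 1) (f : disk R -> C)
    (u : nat -> C) :
  power_series_of f u -> exists v, power_series_of (comp_op ha f) v.
Proof.
move=> fu; have /andP[a0 a1] := ha.
pose b n k : R := 'C(n, k)%:R * a ^+ k * (1 - a) ^+ (n - k).
have b0 n k : 0 <= b n k.
  by rewrite /b !mulr_ge0// exprn_ge0// ?subr_ge0// ltW.
pose t k n : C := u n * toC (b n k).
have cab n k : cabs (t k n) = cabs (u n) * b n k.
  by rewrite /t cabsM cabs_toC ger0_norm.
have rho01 x : 0 <= x < 1 -> 0 <= a * x + 1 - a < 1.
  move=> /andP[x0 x1]; apply/andP; split.
    by rewrite -addrA addr_ge0 ?mulr_ge0 ?subr_ge0// ltW.
  by rewrite -addrA addrCA gtrDl subr_lt0 gtr_pMr.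
have partial_le x n K : 0 <= x ->
    \sum_(k < K) cabs (t k n) * x ^+ k <= cabs (u n) * (a * x + 1 - a) ^+ n.
  move=> x0; under eq_bigr do rewrite cab -mulrA.
  by rewrite -mulr_sumr ler_wpM2l ?cabs_ge0//; exact: affine_expansion_le.
have [v tv] : exists v : nat -> C, forall k, series (t k) @ \oo --> v k.
  suff h k : exists l : C, series (t k) @ \oo --> l.
    by have [v hv] := choice h; exists v.
  (* [v k] does not depend on z: the bound at radius 1/2 is enough *)
  have h2 : 0 <= (2^-1 : R) < 1 by apply/andP; split; lra.
  have := power_series_abs fu (rho01 _ h2).
  move=> /(@is_cvg_seriesZ _ _ (2 ^+ k)).
  apply: dominated_cvgC => n; rewrite /GRing.scale/=.
  have := partial_le 2^-1 n k.+1.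
  rewrite big_ord_recr/= => h; rewrite -ler_pdivrMl ?exprn_gt0//.
  apply: le_trans (h _); last by rewrite invr_ge0.
  rewrite mulrC exprVn lerDr sumr_ge0// => i _.
  by rewrite mulr_ge0 ?cabs_ge0// exprn_ge0.
exists v => z; set x := cabs (val z).
have x01 : 0 <= x < 1 by rewrite cabs_ge0 disk_cabs.
pose y n := cabs (u n) * (a * x + 1 - a) ^+ n.
have cy : cvgn (series y) := power_series_abs fu (rho01 _ x01).
have fz : series (fun n => u n * phi a (val z) ^+ n) @ \oo --> comp_op ha f z.
  exact: (fu (phiD ha z)).
have phiy n : cabs (u n * phi a (val z) ^+ n) <= y n.
  rewrite cabsM cabsX ler_wpM2l ?cabs_ge0// lerXn2r ?nnegrE ?cabs_ge0//.
    by have /andP[] := rho01 _ x01.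
  rewrite /phi -addrA -[1 - _](toCB 1); apply: (le_trans (cabsD _ _)).
  by rewrite cabsM !cabs_toC !ger0_norm ?subr_ge0 ?(ltW a0) ?(ltW a1)// addrA.
pose s K n : C := \sum_(k < K) t k n * val z ^+ k.
have s_le K n : cabs (s K n) <= y n.
  apply: (le_trans (cabs_sum _ _)).
  under eq_bigr do rewrite cabsM cabsX.
  by apply: partial_le; rewrite cabs_ge0.
have sV K : series (s K) @ \oo --> series (fun k => v k * val z ^+ k) K.
  rewrite seriesE; have -> : series (s K) =
      (fun n => \sum_(k < K) series (t k) n * val z ^+ k).
    apply/funext => n; rewrite seriesE /s exchange_big/=.
    by apply: eq_bigr => k _; rewrite seriesE mulr_suml.
  elim: K => [|K IH].
    rewrite big_ord0; under eq_fun do rewrite big_ord0; exact: cvg_cst.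
  rewrite big_ord_recr/=; under eq_fun do rewrite big_ord_recr/=.
  apply: (@cvgD C C^o); first exact: IH.
  by apply: (@cvgM C); [exact: tv|exact: cvg_cst].
apply/cvgCP => e e0.
have e20 : 0 < e / 2 by rewrite divr_gt0.
move/cvgrPdist_lt: (cy) => /(_ _ e20)[N _ /(_ N (leqnn _)) hN].
exists N => // K /= NK.
(* the first N rows, cut at K >= N columns, sum exactly to the N-th partial
   sum of the series of f at [phi a z] *)
have := series_tail N (s_le K) (sV K) cy.
have := series_tail N phiy fz cy.
have -> : series (s K) N = series (fun n => u n * phi a (val z) ^+ n) N.
  rewrite !seriesE; apply: eq_bigr => n _; rewrite /s.
  rewrite (affine_expansion _ _ (leq_trans (ltn_ord n) NK)) mulr_sumr.
  apply: eq_bigr => k _.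
  by rewrite mulrA /t /b !toCM !toCX toC_nat (toCB 1).
set P := series _ N; set V := series _ K => h1 h2.
have -> : comp_op ha f z - V = (comp_op ha f z - P) - (V - P).
  by rewrite opprB addrA subrK.
have := cabsD (comp_op ha f z - P) (- (V - P)); rewrite cabsN => h3.
have := le_lt_trans (ler_norm _) hN; lra.
Qed.

End Composition.

(** * The space H2 and the subspace of constants *)

Section HardySpace.
Variable R : realType.
Local Notation C := (Cplx R).
Implicit Types (f g : disk R -> C) (u v : nat -> C).

Lemma power_series_lin (c : C) f g u v :
  power_series_of f u -> power_series_of g v ->
  power_series_of (c *: f + g) (fun n => c * u n + v n).
Proof.
move=> fu gv z.
have -> : series (fun n => (c * u n + v n) * val z ^+ n) =
    (fun n => c * series (fun n => u n * val z ^+ n) n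
              + series (fun n => v n * val z ^+ n) n).
  apply/funext => n; rewrite !seriesE mulr_sumr -big_split/=.
  by apply: eq_bigr => k _; ring.
apply: (@cvgD C C^o); last exact: gv.
by apply: (@cvgM C); [exact: cvg_cst|exact: fu].
Qed.

Lemma power_series_sub f g u v :
  power_series_of f u -> power_series_of g v ->
  power_series_of (f - g) (fun n => u n - v n).
Proof.
move=> fu gv; have := power_series_lin (c := -1) gv fu.
rewrite scaleN1r addrC; congr (power_series_of _ _).
by apply/funext => n; ring.
Qed.

Lemma power_series_cst (c : C) :
  power_series_of (cst c : disk R -> C) (fun n => if n is 0%N then c else 0).
Proof.
move=> z; apply/cvgCP => e e0; exists 1%N => // n /=.
rewrite big_mkord; case: n => // n _; rewrite big_ord_recl/= expr0 mulr1.
rewrite big1 ?addr0 ?subrr ?cabs0//.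
by move=> i _; rewrite mul0r.
Qed.

Lemma power_series_det f g u :
  power_series_of f u -> power_series_of g u -> f = g.
Proof.
move=> fu gu; apply/funext => z.
exact: (@cvg_unique _ (@norm_hausdorff C C^o) _ _ _ _ (fu z) (gu z)).
Qed.

(** The bound on coefficients by the supremum, applied to [f - f]. *)
Lemma power_series_unique f u v :
  power_series_of f u -> power_series_of f v -> u = v.
Proof.
move=> fu fv; apply/funext => n.
have d := power_series_sub fu fv.
have d0 z : cabs ((f - f) z) <= 0 by rewrite subrr cabs0.
have := coef_sum_le n.+1 d d0.
rewrite expr0n/= big_ord_recr/= => h.
have : cabs (u n - v n) ^+ 2 <= 0.
  by apply: le_trans h; rewrite lerDr sumr_ge0// => i _; rewrite sqr_ge0.
rewrite real_exprn_even_le0 ?num_real//= => /eqP /cabs_eq0 /eqP.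
by rewrite subr_eq0 => /eqP.
Qed.

Lemma taylorE f u : power_series_of f u -> taylor f = u.
Proof.
move=> fu; apply: (power_series_unique _ fu).
exact: (@xgetPex _ _ [set u | power_series_of f u] (ex_intro _ u fu)).
Qed.

(** The H2 norm is at most the supremum norm: uniform convergence on the disk
    implies convergence in H2. *)
Lemma bounded_H2 f u (e : R) :
  power_series_of f u -> (forall z, cabs (f z) <= e) ->
  H2 f /\ H2norm f <= e.
Proof.
move=> fu fe.
have bnd N : series (fun n => cabs (u n) ^+ 2) N <= e ^+ 2.
  by rewrite seriesE; exact: coef_sum_le fe.
have cv : cvgn (series (fun n => cabs (u n) ^+ 2)).
  apply: nondecreasing_is_cvgn.
    by apply: nondecreasing_series => n _ _; rewrite sqr_ge0.
  by exists (e ^+ 2) => _ [N _ <-].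
split; first by exists u.
have e0 : 0 <= e := le_trans (cabs_ge0 _) (fe (disk0 R)).
rewrite /H2norm (taylorE fu) -[leRHS]ger0_norm// -sqrtr_sqr ler_wsqrtr//.
by apply: limr_le => //; exact: nearW.
Qed.

Lemma H2_cst (c : C) : H2 (cst c : disk R -> C).
Proof.
by have [] := @bounded_H2 _ _ (cabs c) (@power_series_cst c) (fun=> lexx _).
Qed.

(** Square-summability of the sum comes from the parallelogram law. *)
Lemma H2_lin (c : C) f g : H2 f -> H2 g -> H2 (c *: f + g).
Proof.
move=> [u [fu cu]] [v [gv cv]]; exists (fun n => c * u n + v n).
split; first exact: power_series_lin.
have := is_cvg_seriesD (@is_cvg_seriesZ _ _ (2 * cabs c ^+ 2) cu)
                       (@is_cvg_seriesZ _ _ 2 cv).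
apply: dominated_cvgn => n; rewrite ger0_norm ?sqr_ge0//.
have := cabs_parallelogram (c * u n) (v n).
have := sqr_ge0 (cabs (c * u n - v n)); rewrite cabsM exprMn => d0 E.
rewrite [leRHS](_ : _ =
  2 * cabs c ^+ 2 * cabs (u n) ^+ 2 + 2 * cabs (v n) ^+ 2)//.
by rewrite -mulrA -mulrDr -E lerDl.
Qed.

Lemma taylor_le_H2norm f n : H2 f -> cabs (taylor f n) <= H2norm f.
Proof.
move=> [u [fu cu]]; rewrite /H2norm (taylorE fu).
rewrite -[leLHS]ger0_norm ?cabs_ge0// -sqrtr_sqr ler_wsqrtr//.
apply: (@le_trans _ _ (series (fun n => cabs (u n) ^+ 2) n.+1)).
  by rewrite seriesE big_ord_recr/= lerDr sumr_ge0// => i _; rewrite sqr_ge0.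
apply: nondecreasing_cvgn_le => //.
by apply: nondecreasing_series => k _ _; rewrite sqr_ge0.
Qed.

Lemma H2norm0 : H2norm (0 : disk R -> C) = 0.
Proof.
have [|_ h] := @bounded_H2 _ _ 0 (@power_series_cst 0).
  by move=> z; rewrite cabs0.
by apply/eqP; rewrite eq_le h sqrtr_ge0.
Qed.

(** Subtracting a constant leaves the coefficients of positive index of [f]
    unchanged, and they are bounded by the distance to that constant. *)
Lemma constants_closed : closed_subspace (range (@cst (disk R) C)).
Proof.
split.
- by move=> _ [c _ <-]; exact: H2_cst.
- by exists 0.
- by move=> c _ _ [x _ <-] [y _ <-]; exists (c * x + y).
- move=> f [Hf hf]; have [u [fu _]] := Hf.
  have u0 n : u n.+1 = 0.
    apply: cabs_eq0; apply/eqP; rewrite eq_le cabs_ge0 andbT.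
    apply/ler_addgt0Pr => e e0; rewrite add0r.
    have [_ [[c _ <-] _] /ltW] := hf _ e0; apply: le_trans.
    have fc : H2 (f - cst c).
      by rewrite addrC -scaleN1r; exact: H2_lin (H2_cst c) Hf.
    have := taylor_le_H2norm n.+1 fc.
    by rewrite (taylorE (power_series_sub fu (@power_series_cst c)))/= subr0.
  exists (u 0%N) => //; apply: (power_series_det (@power_series_cst (u 0%N))).
  rewrite (_ : (fun n => _) = u)//.
  by apply/funext => -[|n].
Qed.

End HardySpace.

(** * Orbits of the composition operator *)

Section Orbit.
Variable R : realType.
Local Notation C := (Cplx R).

Lemma nbhsC_ball (x : C) (U : set C) : nbhs x U ->
  exists2 d : R, 0 < d & forall y : C, cabs (x - y) < d -> U y.
Proof.
move=> /nbhs_normP[e /= e0 eU].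
have eE : e = toC (complex.Re e).
  by move: e e0 {eU} => [e1 e2]; rewrite ltcE /= => /andP[/eqP-> _].
exists (complex.Re e); first by rewrite -ltr_toC -eE.
by move=> y yd; apply: eU; rewrite /= normr_toC eE ltr_toC.
Qed.

#[local] Instance disk_to_1_filter : Filter (@disk_to_1 R).
Proof.
split.
- by rewrite /disk_to_1/=; near=> z.
- move=> P Q hP hQ; rewrite /disk_to_1/=; near=> z => w wz.
  by split; move: w wz; near: z.
- move=> P Q PQ hP; rewrite /disk_to_1/=; near=> z => w wz.
  by apply: PQ; move: w wz; near: z.
Unshelve. all: by end_near. Qed.

Lemma iter_comp_op (a : R) (ha : 0 < a < 1) (f : disk R -> C) n z :
  iter n (comp_op ha) f z = f (iter n (phiD ha) z).
Proof. by elim: n z => // n IH z; rewrite [LHS]IH -iterSr. Qed.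

(** The point 1 is fixed, and the affine map contracts the plane towards it by
    the factor [a]. *)
Lemma val_iter_phiD (a : R) (ha : 0 < a < 1) n (z : disk R) :
  1 - val (iter n (phiD ha) z) = toC (a ^+ n) * (1 - val z).
Proof.
elim: n => [|n IH]; first by rewrite expr0 mul1r.
rewrite exprS toCM -mulrA -IH /= /phi; ring.
Qed.

(** The image of the whole disk under the [n]-th iterate of the affine map lies
    in the disk of centre 1 and radius [2 * a ^+ n], so the limit of [g] at 1
    is approached uniformly. *)
Lemma orbit_cvg_uniform (a : R) (ha : 0 < a < 1) (g : disk R -> C) (L : C) :
  g z @[z --> @disk_to_1 R] --> L -> forall e : R, 0 < e ->
  exists n, forall z, cabs (L - iter n (comp_op ha) g z) < e.
Proof.
move=> /cvgCP gL e /gL /nbhsC_ball [d d0 hd].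
have /andP[a0 a1] := ha.
have : a ^+ n @[n --> \oo] --> 0.
  by apply: cvg_expr; rewrite gtr0_norm.
have d20 : 0 < d / 2 by rewrite divr_gt0.
move=> /cvgrPdist_lt /(_ _ d20) [n _ /(_ n (leqnn _)) /=].
rewrite sub0r normrN gtr0_norm ?exprn_gt0// => and2.
exists n => z; rewrite iter_comp_op; apply: (hd _ _ _ erefl).
rewrite val_iter_phiD cabsM cabs_toC gtr0_norm ?exprn_gt0//.
have z2 : cabs (1 - val z) <= 2.
  apply: (le_trans (cabsD _ _)); rewrite cabsN cabs1.
  by have := disk_cabs z; lra.
apply: (@le_lt_trans _ _ (a ^+ n * 2)).
  by rewrite ler_pM2l ?exprn_gt0.
by rewrite -ltr_pdivlMr.
Qed.

Lemma iter_power_series (a : R) (ha : 0 < a < 1) (g : disk R -> C) n :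
  H2 g -> exists u, power_series_of (iter n (comp_op ha) g) u.
Proof.
move=> [u [gu _]]; elim: n => [|n [v hv]]; first by exists u.
exact: comp_power_series hv.
Qed.

(** Approximate [c] by [c / L] times an element of the orbit of [g]. The
    difference is uniformly small, which gives at once that it belongs to H2
    and that its norm is small. *)
Lemma constants_in_K (a : R) (ha : 0 < a < 1) (g : disk R -> C) (L : C) :
  H2 g -> L != 0 -> g z @[z --> @disk_to_1 R] --> L ->
  forall c : C, K ha g (cst c).
Proof.
move=> hg L0 gL c; split=> [|e e0]; first exact: H2_cst.
pose lam := c / L.
(* the + 1 only keeps the divisor positive when c = 0 *)
have lam0 : 0 < cabs lam + 1 by rewrite ltr_wpDl// cabs_ge0.
have d0 : 0 < e / 2 / (cabs lam + 1) by rewrite !divr_gt0.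
have [n hn] := orbit_cvg_uniform ha gL d0.
set h := iter n _ _ in hn.
have [u hu] := iter_power_series ha n hg; rewrite -/h in hu.
have dif := power_series_lin (c := - lam) hu (@power_series_cst _ c).
rewrite scaleNr addrC in dif.
have bnd z : cabs ((cst c - lam *: h) z) <= e / 2.
  have -> : (cst c - lam *: h) z = lam * (L - h z).
    by rewrite mulrBr divfK.
  rewrite cabsM; apply: (@le_trans _ _ (cabs lam * (e / 2 / (cabs lam + 1)))).
    by rewrite ler_wpM2l ?cabs_ge0// ltW.
  rewrite mulrCA ler_piMr//; first by rewrite divr_ge0// ltW.
  by rewrite ler_pdivrMr// mul1r lerDl.
have [Hd nd] := bounded_H2 dif bnd.
exists (lam *: h); last by apply: le_lt_trans nd _; lra.
split.
  exists 1%N, (fun=> lam), (fun=> h); split; first by move=> _; exists n.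
  by rewrite big_ord1.
have -> : lam *: h = (-1) *: (cst c - lam *: h) + cst c.
  by rewrite scaleN1r opprB subrK.
exact: H2_lin Hd (H2_cst c).
Qed.

Lemma constants_invariant (a : R) (ha : 0 < a < 1) :
  closed_invariant ha (range (@cst (disk R) C)).
Proof.
by split; [exact: constants_closed|move=> _ [c _ <-]; exists c].
Qed.

Lemma constants_dim1 : has_dim 1 (range (@cst (disk R) C)).
Proof.
exists (fun=> cst 1); split.
  move=> c; rewrite big_ord1 => c0 i; rewrite (ord1 i).
  have := congr1 (fun f => f (disk0 R)) c0.
  by rewrite /= [LHS]mulr1.
apply/seteqP; split => f.
  move=> [c _ <-]; exists 1%N, (fun=> c), (fun=> cst 1).
  split; first by move=> _; exists ord0.
  by rewrite big_ord1; apply/funext => z; rewrite [RHS]mulr1.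
move=> [n [c [p [hp ->]]]]; exists (\sum_(i < n) c i) => //.
apply/funext => z; rewrite fct_sumE; apply: eq_bigr => i _.
by have [_ _ <-] := hp i; rewrite [RHS]mulr1.
Qed.

Lemma self_in_K (a : R) (ha : 0 < a < 1) (g : disk R -> C) : H2 g -> K ha g g.
Proof.
move=> hg; split=> // e e0; exists g; last by rewrite subrr H2norm0.
split=> //; exists 1%N, (fun=> 1), (fun=> g).
by split; [move=> _; exists 0%N|rewrite big_ord1 scale1r].
Qed.

End Orbit.

Theorem theorem10 (R : realType) (a : R) (ha : 0 < a < 1)
    (g : disk R -> Cplx R) (L : Cplx R) (hg : H2 g) (hL : L != 0)
    (hlim : g z @[z --> @disk_to_1 R] --> L) :
  (forall c : Cplx R, K ha g (cst c)) /\
  (minimal_invariant ha (K ha g) -> g = cst L /\ has_dim 1 (K ha g)).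
Proof.
have cK := constants_in_K ha hg hL hlim; split=> // -[_ _ minK].
have KE : K ha g = range (@cst (disk R) (Cplx R)).
  have [|N0|->//] := minK _ (constants_invariant ha).
    by move=> _ [c _ <-].
  have : [set 0] (cst 1 : disk R -> Cplx R) by rewrite -N0; exists 1.
  move=> /(congr1 (fun f => f (disk0 R))) /= /eqP.
  by rewrite oner_eq0.
split; last by rewrite KE; exact: constants_dim1.
have := self_in_K ha hg; rewrite KE => -[c _ cg].
suff -> : L = c by [].
apply/eqP; rewrite -subr_eq0; apply/eqP/cabs_eq0/eqP.
rewrite eq_le cabs_ge0 andbT; apply/ler_addgt0Pr => e e0; rewrite add0r.
have [n] := orbit_cvg_uniform ha hlim e0.
by move=> /(_ (disk0 R)); rewrite iter_comp_op -cg => /ltW.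
Qed.
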